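(* Let $1\leq a\leq b$ be two integers, and let $G$ be a graph of order $n$ with $n\geq\frac{(a+2b)(2a+2b-3)+1}{b}$ and $\delta(G)\geq\frac{bn}{a+2b}+a$. If $|N_G(x)\cup N_G(y)|\geq\frac{(a+b)n}{a+2b}$ for any two nonadjacent vertices $x,y\in V(G)$, then $G$ is fractional ID-$[a,b]$-factor-critical.
   Context: All graphs are finite, undirected, without loops or multiple edges. $V(G)$ and $E(G)$ denote the vertex set and edge set of $G$; the order of $G$ is $|V(G)|$; $\delta(G)$ is the minimum degree of $G$; $N_G(x)$ is the set of vertices adjacent to $x$ in $G$. ''Two nonadjacent vertices'' means two distinct vertices not joined by an edge. For $S\subseteq V(G)$, $G-S$ is the subgraph of $G$ induced by $V(G)\setminus S$. For integers $1\leq a\leq b$ and a graph $G$, let $h:E(G)\rightarrow[0,1]$ be a function. If $a\leq\sum_{e\ni x}h(e)\leq b$ holds for every $x\in V(G)$ (the sum being over edges $e$ of $G$ incident with $x$), then $G[F_h]$, where $F_h=\{e\in E(G):h(e)>0\}$, is called a fractional $[a,b]$-factor of $G$ with indicator function $h$. Thus $G$ has a fractional $[a,b]$-factor if and only if such a function $h$ exists. A graph $G$ is fractional independent-set-deletable $[a,b]$-factor-critical (in short, fractional ID-$[a,b]$-factor-critical) if $G-I$ has a fractional $[a,b]$-factor for every independent set $I$ of $G$. *)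

(* Defs.v *)
From HB Require Import structures.
From mathcomp Require Import all_boot all_order all_algebra reals.

Set Implicit Arguments.
Unset Strict Implicit.
Unset Printing Implicit Defensive.

Import Order.TTheory GRing.Theory Num.Theory.

Local Open Scope ring_scope.

Record sgraph := SGraph {
  vertex :> finType;
  adj : rel vertex;
  adj_sym : symmetric adj;
  adj_irrefl : irreflexive adj
}.

Section Graph.
Variable G : sgraph.

Definition neighbours (x : G) : {set G} := [set y | adj x y].

(* An edge is the unordered pair of its endpoints, so x is incident with e
   exactly when x \in e. *)
Definition edges : {set {set G}} :=
  [set [set p.1; p.2] | p : G * G & adj p.1 p.2].

(* The default value #|G| of the minimum is never attained when G has a
   vertex, since every degree is at most #|G| - 1. *)
Definition min_degree : nat :=
  \big[minn/#|G|%N]_(x : G) #|neighbours x|.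

Definition independent (I : {set G}) : bool :=
  [forall x in I, forall y in I, ~~ adj x y].

Definition del_adj (S : {set G}) : rel {x : G | x \notin S} :=
  fun x y => adj (val x) (val y).

Lemma del_adj_sym S : symmetric (@del_adj S).
Proof. by move=> x y; apply: adj_sym. Qed.

Lemma del_adj_irrefl S : irreflexive (@del_adj S).
Proof. by move=> x; apply: adj_irrefl. Qed.

Definition del_vertices (S : {set G}) : sgraph :=
  SGraph (@del_adj_sym S) (@del_adj_irrefl S).

End Graph.

(* The indicator function lives on E(G): only its values on edges G are ever
   constrained or summed. *)
Definition fractional_indicator (R : realType) (a b : nat) (G : sgraph)
    (h : {set G} -> R) : Prop :=
  (forall e, e \in edges G -> 0 <= h e <= 1) /\
  (forall x : G, a%:R <= \sum_(e in edges G | x \in e) h e <= b%:R).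

Definition has_fractional_factor (R : realType) (a b : nat) (G : sgraph) :
    Prop :=
  exists h : {set G} -> R, fractional_indicator a b h.

Definition fractional_ID_factor_critical (R : realType) (a b : nat)
    (G : sgraph) : Prop :=
  forall I : {set G}, independent I ->
    has_fractional_factor R a b (del_vertices I).

(* Main.v *)
Require Import Defs.
From mathcomp Require Import all_boot all_order all_algebra reals.
From mathcomp Require Import zify ring lra.

Import Order.TTheory GRing.Theory Num.Theory.

(** Two ingredients give the theorem.

    The first is Anstee's criterion, [fractional_factor_criterion]: a graph has
    a fractional [a,b]-factor as soon as
      a|T| <= b|S| + sum_(x in T) d_(G-S)(x)
    for all disjoint S and T.  Averaging the two orientations of each edge
    turns a set of arcs of G, all of whose in- and out-degrees lie between a
    and b, into such a factor ([fractional_factor_of_arcs]).  Such a set of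
    arcs is a degree-constrained subgraph of the bipartite double cover of G.
    It is obtained by alternating paths: starting from a subgraph with
    degrees at most b, either a path from a vertex of degree less than a
    reduces the total deficiency, or the vertices reached form a cut (A, B)
    that violates the analogous bipartite condition ([row_augment]).  In the
    double cover A and B are subsets of the same vertex set and may meet;
    removing the common part from both only makes the violation worse, because
    a <= b ([uncross_cut]).

    The second is the count in H = G - I.  Put t = bn/(a+2b), so that the
    neighbourhood hypothesis reads |N(x) u N(y)| >= n - t; it forces |I| <= t,
    since two vertices of I have no neighbour in I.  Given S and T, with all
    d(x) = d_(H-S)(x) less than a on T, let x1 minimize d on T, with value h1,
    and let x2 minimize d on the part of T outside the closed neighbourhood of
    x1, with value h2.  That closed neighbourhood contains at most h1 + 1
    vertices of T.  If it contains all of T, the bound on the minimum degree,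
    applied at x1, gives |S| >= a - h1, and this suffices ([clique_case]).
    Otherwise x1 and x2 are not adjacent, the neighbourhood hypothesis bounds
    |S| from below by n - t - |I| - h1 - h2, and the lower bound on n finishes
    the count ([two_minima_case]). *)

Set Implicit Arguments.
Unset Strict Implicit.
Unset Printing Implicit Defensive.

Local Open Scope ring_scope.

(** * Bipartite graphs as sets of pairs *)

Section RowColumn.
Local Open Scope nat_scope.
Variables L R : finType.
Implicit Types (M : {set L * R}) (u w x : L) (v y : R).

Definition row_deg M u := #|[set v | (u, v) \in M]|.
Definition col_deg M v := #|[set u | (u, v) \in M]|.

Lemma row_degU1 M u v x :
  (u, v) \notin M -> row_deg ((u, v) |: M) x = row_deg M x + (x == u).
Proof.
move=> uvM; rewrite /row_deg; case: (x =P u) => [->|xu]; last first.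
  rewrite addn0; apply: eq_card => y; rewrite !inE xpair_eqE.
  by case: (x =P u) xu.
rewrite addn1 -[RHS]/(1 + _).
have -> : [set y | (u, y) \in (u, v) |: M] = v |: [set y | (u, y) \in M].
  by apply/setP=> y; rewrite !inE xpair_eqE eqxx.
by rewrite cardsU1 inE uvM.
Qed.

Lemma col_degU1 M u v y :
  (u, v) \notin M -> col_deg ((u, v) |: M) y = col_deg M y + (y == v).
Proof.
move=> uvM; rewrite /col_deg; case: (y =P v) => [->|yv]; last first.
  rewrite addn0; apply: eq_card => x; rewrite !inE xpair_eqE.
  by case: (y =P v) yv => //; rewrite andbF.
rewrite addn1 -[RHS]/(1 + _).
have -> : [set x | (x, v) \in (u, v) |: M] = u |: [set x | (x, v) \in M].
  by apply/setP=> x; rewrite !inE xpair_eqE eqxx andbT.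
by rewrite cardsU1 inE uvM.
Qed.

Lemma row_degD1 M u v x :
  (u, v) \in M -> row_deg (M :\ (u, v)) x + (x == u) = row_deg M x.
Proof.
by move=> uvM; rewrite -(row_degU1 (v := v)) ?setD1K // !inE eqxx.
Qed.

Lemma col_degD1 M u v y :
  (u, v) \in M -> col_deg (M :\ (u, v)) y + (y == v) = col_deg M y.
Proof.
by move=> uvM; rewrite -(col_degU1 (u := u)) ?setD1K // !inE eqxx.
Qed.

End RowColumn.

(** * Alternating paths *)

Section Augmentation.
Local Open Scope nat_scope.
Variables (L R : finType) (E : L -> R -> bool) (a b : nat).
Implicit Types (M : {set L * R}) (u w x : L) (v y : R).

Definition edge_set : {set L * R} := [set p | E p.1 p.2].

(** A two-step alternating move between left vertices: enter the right side
    along an edge missing from [M], return along an edge of [M]. *)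
Definition alternates M : rel L :=
  fun u w => [exists v, [&& E u v, (u, v) \notin M & (w, v) \in M]].

(** Exchanging the edges along an alternating path moves one unit of degree
    from its last vertex to its first and changes no other degree.  The path
    is treated one move at a time, so the rest of it must still alternate after
    the first exchange: the edges altered there lie in the rows of [u] and [w],
    and since the left vertices of the path are distinct, the rest of the path
    uses neither [u] nor an edge of [M] in the row of [w].  The last
    conclusion allows the path to be prolonged by one more edge out of its
    last vertex. *)
Lemma shift_along_path M u p :
    M \subset edge_set -> path (alternates M) u p -> uniq (u :: p) ->
  exists M', [/\ M' \subset edge_set,
    forall y, col_deg M' y = col_deg M y,
    forall x, row_deg M' x + (x == last u p) = row_deg M x + (x == u) &
    forall y, (last u p, y) \in M' -> (last u p, y) \in M].
Proof.
elim: p u M => [|w p IHp] u M ME; first by exists M.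
move=> /= /andP[/existsP[v /and3P[Euv uvM wvM]] pathM].
rewrite inE negb_or => /andP[/andP[uw up] wp_uniq].
have [wp p_uniq] := andP wp_uniq.
pose M1 := (u, v) |: (M :\ (w, v)).
have uvM0 : (u, v) \notin M :\ (w, v) by rewrite !inE negb_and uvM orbT.
have M1E : M1 \subset edge_set.
  apply/subsetP=> q; rewrite !inE => /orP[/eqP->//|/andP[_ /(subsetP ME)]].
  by rewrite inE.
have pathM1 : path (alternates M1) w p.
  apply/(pathP w) => i lt_i.
  have /existsP[y /and3P[Exy xyM zyM]] := pathP w pathM i lt_i.
  have xu : (nth w (w :: p) i == u) = false.
    apply/negbTE; apply: contraTneq (mem_nth w (_ : i < size (w :: p))) => [->|].
      by rewrite inE (negbTE uw).
    by rewrite ltnW.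
  have zp := mem_nth w lt_i.
  have zu : (nth w p i == u) = false by apply/negbTE; apply: contraTneq zp => ->.
  have zw : (nth w p i == w) = false by apply/negbTE; apply: contraTneq zp => ->.
  apply/existsP; exists y.
  by rewrite Exy !inE !xpair_eqE xu zu zw /= (negbTE xyM) andbF.
have [M' [M'E colM' rowM' lastM']] := IHp w M1 M1E pathM1 wp_uniq.
exists M'; split=> // [y|x|y].
- by rewrite colM' col_degU1 // col_degD1.
- by rewrite rowM' row_degU1 // addnAC row_degD1.
- have last_u : (last w p == u) = false.
    apply/negbTE; apply: contraTneq (mem_last w p) => ->.
    by rewrite inE (negbTE uw).
  by move/lastM'; rewrite !inE xpair_eqE last_u /= => /andP[].
Qed.

Definition degrees_at_most M :=
  (forall u, row_deg M u <= b) /\ (forall v, col_deg M v <= b).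

(** Truncated subtraction makes degrees above [a] contribute nothing. *)
Definition deficiency M :=
  \sum_u (a - row_deg M u) + \sum_v (a - col_deg M v).

Lemma ltn_deficiency M M' u :
    (forall x, a - row_deg M' x <= a - row_deg M x) ->
    (forall y, a - col_deg M' y <= a - col_deg M y) ->
    a - row_deg M' u < a - row_deg M u ->
  deficiency M' < deficiency M.
Proof.
move=> rowM colM ltu; rewrite /deficiency -addSn leq_add ?leq_sum //.
rewrite (bigD1 u) //= [X in _ < X](bigD1 u) //= -addSn leq_add //.
by apply: leq_sum.
Qed.

Hypothesis ab : a <= b.

(** An alternating path from [u0] can end in two useful ways: at a left vertex
    with degree to spare, or, one edge further, at a right vertex with room for
    one more edge.  If neither happens, let [A] be the left vertices reached
    and [B] the right vertices one unused edge away.  Every [M]-edge into [B]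
    comes from [A], every edge of [E] from [A] to the complement of [B] is in
    [M], and the degrees are at most [a] on [A] and equal to [b] on [B];
    counting the edges of [M] out of [A] then contradicts the cut condition,
    the inequality being strict because of [u0]. *)
Lemma row_augment M u0 :
    (forall (A : {set L}) (B : {set R}),
       a * #|A| <= b * #|B| + \sum_(u in A) #|[set v | E u v] :\: B|) ->
    M \subset edge_set -> degrees_at_most M -> row_deg M u0 < a ->
  exists M', [/\ M' \subset edge_set, degrees_at_most M' &
                 deficiency M' < deficiency M].
Proof.
move=> cut ME [rowMb colMb] u0a.
have shift w : connect (alternates M) u0 w -> exists M', [/\ M' \subset edge_set,
    forall y, col_deg M' y = col_deg M y,
    forall x, row_deg M' x + (x == w) = row_deg M x + (x == u0) &
    forall y, (w, y) \in M' -> (w, y) \in M].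
  case/connectP=> p pathp ->; case/shortenP: pathp => p' pathp' uniqp' _.
  exact: shift_along_path.
pose A := [set w | connect (alternates M) u0 w].
pose B := [set v | [exists w in A, E w v && ((w, v) \notin M)]].
case: (boolP [exists w in A, a < row_deg M w]) => [/exists_inP[w]|].
  rewrite inE => /shift[M' [M'E colM' rowM' _]] aw.
  have wu0 : (u0 == w) = false by apply/negbTE; apply: contraTneq aw => <-; lia.
  exists M'; split=> //; first split=> [x|y].
  - have := rowM' x; have := rowMb x; case: (x =P u0) => [->|_]; lia.
  - by rewrite colM'.
  apply: (@ltn_deficiency _ _ u0) => [x|y|]; last 2 first.
  - by rewrite colM'.
  - by have := rowM' u0; rewrite eqxx wu0; lia.
  by have := rowM' x; case: (x =P w) => [->|_]; lia.
rewrite negb_exists_in => /forall_inP A_le_a.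
case: (boolP [exists v in B, col_deg M v < b]) => [/exists_inP[v]|].
  rewrite inE => /exists_inP[w]; rewrite inE.
  move=> /shift[M' [M'E colM' rowM' lastM']] /andP[Ewv wvM] vb.
  have wvM' : (w, v) \notin M' by apply: contra wvM => /lastM'.
  have rowM2 x : row_deg ((w, v) |: M') x = row_deg M x + (x == u0).
    by rewrite row_degU1.
  have colM2 y : col_deg ((w, v) |: M') y = col_deg M y + (y == v).
    by rewrite col_degU1 // colM'.
  exists ((w, v) |: M'); split; last 1 first.
  - apply: (@ltn_deficiency _ _ u0) => [x|y|]; rewrite ?rowM2 ?colM2 ?eqxx; lia.
  - by apply/subsetP=> q /setU1P[->|/(subsetP M'E)//]; rewrite inE.
  split=> [x|y]; rewrite ?rowM2 ?colM2.
  - by have := rowMb x; case: (x =P u0) => [->|_]; lia.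
  - by have := colMb y; case: (y =P v) => [->|_]; lia.
rewrite negb_exists_in => /forall_inP B_ge_b.
have u0A : u0 \in A by rewrite inE connect0.
have lt_rows : \sum_(u in A) row_deg M u < a * #|A|.
  rewrite mulnC -sum_nat_const (bigD1 u0) //= [X in _ < X](bigD1 u0) //=.
  rewrite -addSn leq_add // leq_sum // => w /andP[wA _].
  by rewrite leqNgt A_le_a.
have rows_B : \sum_(u in A) #|[set v | (u, v) \in M] :&: B| = b * #|B|.
  transitivity (\sum_(u in A) \sum_(v in B) ((u, v) \in M : nat)).
    apply: eq_bigr => u _; rewrite -sum1_card big_mkcond /= [RHS]big_mkcond /=.
    by apply: eq_bigr => v _; rewrite in_setI inE; case: (v \in B); case: ((u, v) \in M).
  rewrite exchange_big /= mulnC -sum_nat_const; apply: eq_bigr => v vB.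
  have <- : col_deg M v = b.
    by apply/eqP; rewrite eqn_leq colMb leqNgt B_ge_b.
  rewrite /col_deg -sum1_card big_mkcond /= [RHS]big_mkcond /=.
  apply: eq_bigr => u _; rewrite !inE.
  case: (boolP (connect _ _ _)) => [_|uA]; first by case: ((u, v) \in M).
  case: ifP => // uvM; case/negP: uA.
  move: vB; rewrite inE => /exists_inP[w]; rewrite inE => u0w /andP[Ewv wvM].
  apply: connect_trans u0w (connect1 _).
  by apply/existsP; exists v; rewrite Ewv wvM.
have := cut A B; rewrite leqNgt => /negP[]; apply: leq_ltn_trans lt_rows.
rewrite -rows_B -big_split leq_sum // => u uA /=.
rewrite /row_deg -[X in _ <= X](cardsID B) leq_add2l subset_leq_card //.
apply/subsetP=> v; rewrite !inE => /andP[vB Euv]; rewrite vB /=.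
by apply: contraR vB => uvM; apply/exists_inP; exists u; rewrite // Euv.
Qed.

End Augmentation.

(** * Degree-constrained subgraphs of bipartite graphs *)

Section Transpose.
Local Open Scope nat_scope.
Variables (L R : finType).

Definition transpose (M : {set L * R}) : {set R * L} :=
  [set p | (p.2, p.1) \in M].

Lemma row_deg_transpose M v : row_deg (transpose M) v = col_deg M v.
Proof. by apply: eq_card => u; rewrite !inE. Qed.

Lemma col_deg_transpose M u : col_deg (transpose M) u = row_deg M u.
Proof. by apply: eq_card => v; rewrite !inE. Qed.

End Transpose.

Lemma transposeK (L R : finType) : cancel (@transpose L R) (@transpose R L).
Proof. by move=> M; apply/setP=> -[u v]; rewrite !inE. Qed.

Lemma deficiency_transpose (L R : finType) a (M : {set L * R}) :
  deficiency a (transpose M) = deficiency a M.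
Proof.
rewrite /deficiency addnC; congr (_ + _)%N; apply: eq_bigr => x _.
- by rewrite col_deg_transpose.
- by rewrite row_deg_transpose.
Qed.

(** Deficient columns are treated as deficient rows of the transpose, so both
    kinds of cut condition are needed; the deficiency decreases at each step. *)
Lemma bipartite_factor (L R : finType) (E : L -> R -> bool) (a b : nat) :
    (a <= b)%N ->
    (forall (A : {set L}) (B : {set R}),
      a * #|A| <= b * #|B| + \sum_(u in A) #|[set v | E u v] :\: B|)%N ->
    (forall (B : {set R}) (A : {set L}),
      a * #|B| <= b * #|A| + \sum_(v in B) #|[set u | E u v] :\: A|)%N ->
  exists M : {set L * R}, [/\ M \subset edge_set E,
    forall u, (a <= row_deg M u <= b)%N & forall v, (a <= col_deg M v <= b)%N].
Proof.
move=> ab cutL cutR.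
pose P k := exists M : {set L * R}, [/\ M \subset edge_set E,
  degrees_at_most b M & deficiency a M = k].
suff H k : P k -> exists M : {set L * R}, [/\ M \subset edge_set E,
    forall u, (a <= row_deg M u <= b)%N & forall v, (a <= col_deg M v <= b)%N].
  apply: (H (deficiency a (set0 : {set L * R}))); exists set0; split=> //.
    exact: sub0set.
  split=> x; rewrite /row_deg /col_deg; apply/(leq_trans (n := 0))=> //;
    by rewrite leqn0 cards_eq0; apply/eqP/setP=> y; rewrite !inE.
elim/ltn_ind: k => k IHk [M [ME Mb defM]].
case: (boolP [forall u, a <= row_deg M u]%N) => [/forallP aM|].
  case: (boolP [forall v, a <= col_deg M v]%N) => [/forallP aM'|].
    by have [Mb1 Mb2] := Mb; exists M; split=> // x; rewrite ?aM ?aM' /=.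
  rewrite negb_forall => /existsP[v]; rewrite -ltnNge => va.
  have [||||M' [M'E M'b ltM']] :=
      @row_augment R L (fun v u => E u v) a b ab (transpose M) v.
  - exact: cutR.
  - by apply/subsetP=> q; rewrite !inE => /(subsetP ME); rewrite inE.
  - have [Mb1 Mb2] := Mb.
    by split=> x; rewrite ?row_deg_transpose ?col_deg_transpose.
  - by rewrite row_deg_transpose.
  apply: (IHk (deficiency a (transpose M'))).
    by rewrite -defM deficiency_transpose -(deficiency_transpose a M).
  exists (transpose M'); split=> //.
    by apply/subsetP=> q; rewrite !inE => /(subsetP M'E); rewrite inE.
  have [Mb1 Mb2] := M'b.
  by split=> x; rewrite ?row_deg_transpose ?col_deg_transpose.
rewrite negb_forall => /existsP[u]; rewrite -ltnNge => ua.
have [M' [M'E M'b ltM']] := row_augment ab cutL ME Mb ua.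
by apply: (IHk (deficiency a M')); [rewrite -defM | exists M'].
Qed.

(** * A criterion for fractional factors *)

Section FractionalFactor.
Variable G : sgraph.

Definition arcs_over (M : {set G * G}) (e : {set G}) : {set G * G} :=
  [set p in M | [set p.1; p.2] == e].

Lemma card_arcs_over M e : (#|arcs_over M e| <= 2)%N.
Proof.
have [->|[p]] := set_0Vmem (arcs_over M e); first by rewrite cards0.
rewrite inE => /andP[_ /eqP <-].
apply: leq_trans (_ : #|[set p; (p.2, p.1)]| <= 2)%N; last first.
  by rewrite cards2; case: eqP.
apply/subset_leq_card/subsetP=> q; rewrite !inE => /andP[_ /eqP eq_qp].
have q1 : q.1 \in [set p.1; p.2] by rewrite -eq_qp set21.
have q2 : q.2 \in [set p.1; p.2] by rewrite -eq_qp set22.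
have p1 : p.1 \in [set q.1; q.2] by rewrite eq_qp set21.
have p2 : p.2 \in [set q.1; q.2] by rewrite eq_qp set22.
move: q1 q2 p1 p2; case: p {eq_qp} => u v; case: q => u' v' /=.
rewrite !inE !xpair_eqE (eq_sym u) (eq_sym u) (eq_sym v) (eq_sym v).
by do 4!case: eqP => //.
Qed.

Lemma sum_arcs_over (M : {set G * G}) x : M \subset edge_set (@adj G) ->
  (\sum_(e in edges G | x \in e) #|arcs_over M e| = row_deg M x + col_deg M x)%N.
Proof.
move=> ME.
have -> : (\sum_(e in edges G | x \in e) #|arcs_over M e| =
    #|[set p in M | x \in [set p.1; p.2]]|)%N.
  rewrite -sum1_card (partition_big (fun p => [set p.1; p.2])
     (fun e => (e \in edges G) && (x \in e))) /=; last first.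
    move=> p; rewrite inE => /andP[pM ->]; rewrite andbT.
    by apply/imsetP; exists p => //; move/(subsetP ME): pM; rewrite !inE.
  apply: eq_bigr => e /andP[_ xe]; rewrite -sum1_card; apply: eq_bigl => p.
  case: (altP ([set p.1; p.2] =P e)) => [pe|/negbTE ne]; rewrite !inE ?pe ?ne ?andbF //.
  by move: xe; rewrite -pe !inE eqxx => ->; rewrite !andbT.
have -> : [set p in M | x \in [set p.1; p.2]] =
    [set (x, y) | y in [set y | (x, y) \in M]] :|:
    [set (y, x) | y in [set y | (y, x) \in M]].
  apply/setP=> -[u v]; rewrite !inE /=; apply/andP/orP.
    by case=> uvM /orP[]/eqP xE; [left|right]; apply/imsetP;
      [exists v|exists u]; rewrite ?inE xE.
  by case=> /imsetP[y]; rewrite inE => yM [-> ->]; rewrite eqxx ?orbT.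
rewrite cardsU !card_imset; try by move=> y z [->].
rewrite [X in (_ - X)%N](_ : _ = 0)%N ?subn0 //.
apply/eqP; rewrite cards_eq0; apply/eqP/setP=> -[u v]; rewrite !inE.
apply/negbTE/negP=> /andP[/imsetP[y]]; rewrite inE => xyM [-> ->].
case/imsetP=> z; rewrite inE => zM [xz yx]; move/(subsetP ME): xyM.
by rewrite inE /= yx adj_irrefl.
Qed.

(** The weight of an edge is half the number of its orientations in [M], so the
    weight at a vertex is the mean of its out-degree and its in-degree. *)
Lemma fractional_factor_of_arcs (R : realType) (a b : nat) (M : {set G * G}) :
    M \subset edge_set (@adj G) ->
    (forall x, a <= row_deg M x <= b)%N -> (forall x, a <= col_deg M x <= b)%N ->
  has_fractional_factor R a b G.
Proof.
move=> ME rowM colM; exists (fun e => #|arcs_over M e|%:R / 2); split=> [e _|x].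
  have := card_arcs_over M e; rewrite -(ler_nat R) => le2.
  by rewrite divr_ge0 ?ler0n //= ler_pdivrMr ?mul1r.
rewrite -big_distrl /= -natr_sum sum_arcs_over //.
have := rowM x; have := colM x; rewrite -!(ler_nat R) natrD.
by move=> /andP[? ?] /andP[? ?]; apply/andP; split; lra.
Qed.

(** Put [C = A :&: B].  Deleting [C] from both sets changes the two main terms
    by [a * #|C|] and [b * #|C|], in the favourable direction as [a <= b].
    Deleting it from [B] also adds the edges between [A :\: B] and [C] to the
    sum, but the sum over [A] already counts them from the side of [C]. *)
Lemma uncross_cut (a b : nat) (A B : {set G}) : (a <= b)%N ->
    (a * #|A :\: B| <= b * #|B :\: A| +
       \sum_(x in A :\: B) #|neighbours x :\: (B :\: A)|)%N ->
  (a * #|A| <= b * #|B| + \sum_(x in A) #|neighbours x :\: B|)%N.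
Proof.
move=> ab.
pose C := A :&: B.
have cardA : (#|A| = #|C| + #|A :\: B|)%N by rewrite /C cardsID.
have cardB : (#|B| = #|C| + #|B :\: A|)%N by rewrite /C setIC cardsID.
have split_nbr x : x \in A :\: B -> (#|neighbours x :\: (B :\: A)| =
    #|neighbours x :\: B| + #|neighbours x :&: C|)%N.
  move=> _; rewrite -(cardsID C (_ :\: (_ :\: A))) addnC; congr (_ + _)%N.
    by apply: eq_card => y; rewrite !inE; case: (y \in A); case: (y \in B); rewrite ?andbF.
  by apply: eq_card => y; rewrite !inE; case: (y \in A); case: (y \in B); rewrite ?andbF ?andbT.
have sumC : (\sum_(x in A :\: B) #|neighbours x :&: C| =
    \sum_(x in C) #|neighbours x :&: (A :\: B)|)%N.
  have dc (X Y : {set G}) : (\sum_(x in X) #|neighbours x :&: Y| =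
      \sum_(x in X) \sum_(y in Y) (adj x y : nat))%N.
    apply: eq_bigr => x _; rewrite -sum1_card big_mkcond /= [RHS]big_mkcond /=.
    by apply: eq_bigr => y _; rewrite !inE; case: (y \in Y); case: (adj x y).
  rewrite !dc exchange_big /=; apply: eq_bigr => x _; apply: eq_bigr => y _.
  by rewrite adj_sym.
rewrite (eq_bigr _ split_nbr) big_split /= sumC.
rewrite [X in (_ -> _ <= _ + X)%N](big_setID B) /= -/C.
have : (\sum_(x in C) #|neighbours x :&: (A :\: B)| <=
        \sum_(x in C) #|neighbours x :\: B|)%N.
  apply: leq_sum => x _; apply/subset_leq_card/subsetP=> y; rewrite !inE.
  by case/and3P=> -> ->.
rewrite cardA cardB !mulnDr; have := leq_mul ab (leqnn #|C|); lia.
Qed.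

(** Only sets [T] of vertices of degree less than [a] in [G - S] have to be
    tested, as a vertex of larger degree contributes at least as much to the
    right side as to the left one. *)
Lemma fractional_factor_criterion (R : realType) (a b : nat) : (a <= b)%N ->
    (forall S T : {set G}, [disjoint S & T] ->
       (forall x, x \in T -> #|neighbours x :\: S| < a)%N ->
       (a * #|T| <= b * #|S| + \sum_(x in T) #|neighbours x :\: S|)%N) ->
  has_fractional_factor R a b G.
Proof.
move=> ab crit.
have cut (A B : {set G}) :
    (a * #|A| <= b * #|B| + \sum_(x in A) #|neighbours x :\: B|)%N.
  apply: uncross_cut => //; set T := A :\: B; set S := B :\: A.
  have disST : [disjoint S & T].
    rewrite -setI_eq0; apply/eqP/setP=> x; rewrite !inE.
    by case: (x \in A); rewrite ?andbF.
  pose T' := [set x in T | #|neighbours x :\: S| < a]%N.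
  have sT'T : T' \subset T by apply/subsetP=> x; rewrite inE => /andP[].
  have lowT' x : x \in T' -> (#|neighbours x :\: S| < a)%N.
    by rewrite inE => /andP[].
  have := crit S T' (disjointWr sT'T disST) lowT'.
  rewrite (big_setID T' (A := T)) /= (setIidPr sT'T) -(cardsID T' T) (setIidPr sT'T).
  suff : (a * #|T :\: T'| <= \sum_(x in T :\: T') #|neighbours x :\: S|)%N.
    by rewrite mulnDr; lia.
  rewrite mulnC -sum_nat_const; apply: leq_sum => x; rewrite !inE.
  by case/andP=> + xT; rewrite xT /= -leqNgt.
have [|B A|M [ME rowM colM]] := @bipartite_factor G G (@adj G) a b ab.
- exact: cut.
- rewrite (eq_bigr (fun x => #|neighbours x :\: A|)) // => x _.
  by congr #|pred_of_set (_ :\: _)|; apply/setP=> y; rewrite !inE adj_sym.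
exact: fractional_factor_of_arcs ME rowM colM.
Qed.

End FractionalFactor.

(** * Counting in G - I *)

Lemma min_degree_le (G : sgraph) (x : G) : (min_degree G <= #|neighbours x|)%N.
Proof.
rewrite /min_degree; have := mem_index_enum x; elim: (index_enum _) => //= y s IHs.
rewrite inE big_cons => /predU1P[->|/IHs]; first exact: geq_minl.
exact: leq_trans (geq_minr _ _).
Qed.

Section DeletedVertices.
Local Open Scope nat_scope.
Variables (G : sgraph) (I : {set G}).

Lemma card_le_del (X : {set G}) (Y : {set del_vertices I}) :
  (forall y : del_vertices I, val y \in X -> y \in Y) -> #|X| <= #|I| + #|Y|.
Proof.
move=> XY; rewrite -(card_imset (mem Y) val_inj).
apply: leq_trans (leq_card_setU I [set val y | y in Y]).
apply/subset_leq_card/subsetP=> x xX; rewrite inE.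
case: (boolP (x \in I)) => //= xI; apply/imsetP.
by exists (Sub x xI : del_vertices I); rewrite ?SubK //; apply: XY; rewrite SubK.
Qed.

Lemma card_del_le (Y : {set del_vertices I}) : #|I| + #|Y| <= #|G|.
Proof.
rewrite -(card_imset (mem Y) val_inj) -cardsUI.
rewrite (_ : I :&: _ = set0) ?cards0 ?addn0 ?max_card //.
apply/setP=> x; rewrite !inE; apply/negbTE/negP=> /andP[xI /imsetP[y _ xy]].
by have := valP y; rewrite -xy xI.
Qed.

End DeletedVertices.

Section Arithmetic.
Variables (F : realFieldType) (a b n t s i h1 h2 p q : F).

(** Here [p] stands for [#|T|], the set [T] lying in a closed neighbourhood;
    the claim is [(a - h1) * p <= b * s], where [s >= a - h1] and
    [p <= h1 + 1 <= a <= b]. *)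
Lemma clique_case :
    a <= b -> h1 + 1 <= a -> 0 <= h1 -> p <= h1 + 1 -> t + a <= s + h1 + i -> i <= t ->
  a * p <= b * s + h1 * p.
Proof.
move=> ab h1a h1_ge0 ph ts it.
have b_ge0 : 0 <= b by lra.
have : 0 <= b * (s - (a - h1)) by apply: mulr_ge0; lra.
have : 0 <= (a - h1) * (b - p) by apply: mulr_ge0; lra.
by lra.
Qed.

(** Here [p] and [q] count the vertices of [T] inside and outside the closed
    neighbourhood of [x1].  If the conclusion fails, the linear bounds on [p],
    [p + q], [s] and [i] combine, through [t * (a + 2 * b) = b * n], to
      h2 * t + 1 <= (a + b - h2) * (h1 + h2) + (h2 - h1) * (h1 + 1).
    The right side is at most its value [2 * h2 * (a + b - h2)] at [h1 = h2];
    for [h2 >= 1] the bound [t > 2a + 2b - 3] then gives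
    [(2 * h2 - 1) * (h2 - 1) < 0], which is absurd.  The conclusion is stated
    with [+ 1] because the quantities are integers and this slack is used when
    [h2 = 0] or [h2 = 1]. *)
Lemma two_minima_case :
    a <= b -> t * (a + 2 * b) = b * n ->
    0 <= h1 -> h1 <= h2 -> h2 + 1 <= a -> h2 = 0 \/ 1 <= h2 ->
    2 * a + 2 * b - 3 < t ->
    p <= h1 + 1 -> i + s + (p + q) <= n -> i <= t ->
    n - t <= i + s + h1 + h2 ->
  a * (p + q) < b * s + (h1 * p + h2 * q) + 1.
Proof.
move=> ab tE h1_ge0 h12 h2a h2_01 tab ph isT_n it nt; rewrite ltNge; apply/negP=> viol.
have b_ge0 : 0 <= b by lra.
(* Each [f] is one of the bounds times its nonnegative multiplier. *)
have f1 : 0 <= (a - h2) * (n - s - i - (p + q)) by apply: mulr_ge0; lra.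
have f2 : 0 <= (h2 - h1) * (h1 + 1 - p) by apply: mulr_ge0; lra.
have f3 : 0 <= (a + b - h2) * (i + s + h1 + h2 - (n - t)) by apply: mulr_ge0; lra.
have f4 : 0 <= b * (t - i) by apply: mulr_ge0; lra.
have f5 : 0 <= (h2 - h1) * (a + b - h2 - h1 - 1) by apply: mulr_ge0; lra.
have key : h2 * t + 1 <= 2 * h2 * (a + b - h2) by lra.
case: h2_01 => [h20|h2_ge1]; first by move: key; rewrite h20; lra.
have f6 : 0 < h2 * (t - (2 * a + 2 * b - 3)) by apply: mulr_gt0; lra.
have f7 : 0 <= (2 * h2 - 1) * (h2 - 1) by apply: mulr_ge0; lra.
by lra.
Qed.

End Arithmetic.

Theorem theorem1 (R : realType) (a b : nat) (G : sgraph) (n : nat)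
  (ha : (1 <= a)%N) (hab : (a <= b)%N)
  (hn : #|G| = n)
  (hn_ge : n%:R >= ((a%:R + 2 * b%:R) * (2 * a%:R + 2 * b%:R - 3) + 1)
                     / b%:R :> R)
  (hdeg : (min_degree G)%:R >= b%:R * n%:R / (a%:R + 2 * b%:R) + a%:R :> R)
  (hnbr : forall x y : G, x != y -> ~~ adj x y ->
     #|neighbours x :|: neighbours y|%:R
       >= (a%:R + b%:R) * n%:R / (a%:R + 2 * b%:R) :> R) :
  fractional_ID_factor_critical R a b G.
Proof.
move=> I /forall_inP indI.
have aR : 1 <= a%:R :> R by rewrite (ler_nat R 1).
have abR : a%:R <= b%:R :> R by rewrite ler_nat.
have ab_neq0 : a%:R + 2 * b%:R != 0 :> R by rewrite gt_eqF //; lra.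
set t : R := b%:R * n%:R / (a%:R + 2 * b%:R) in hdeg.
have tE : t * (a%:R + 2 * b%:R) = b%:R * n%:R by rewrite divfK.
have ntE : (a%:R + b%:R) * n%:R / (a%:R + 2 * b%:R) = n%:R - t.
  by rewrite /t; field.
rewrite ntE in hnbr.
have t_gt : 2 * a%:R + 2 * b%:R - 3 < t.
  rewrite ler_pdivrMr in hn_ge; last by lra.
  by rewrite -(ltr_pM2r (_ : 0 < a%:R + 2 * b%:R)) ?tE; lra.
(* Two vertices of [I] have all their neighbours outside [I]; if [I] has at
   most one vertex, the bound follows from [t > 1]. *)
have It : #|I|%:R <= t.
  have [I1|/card_gt1P[x [y [xI yI xy]]]] := leqP #|I| 1.
    by apply: le_trans (_ : 1 <= _); [rewrite (ler_nat R _ 1) | lra].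
  have := hnbr x y xy (forall_inP (indI x xI) y yI).
  have : (#|neighbours x :|: neighbours y| + #|I| <= n)%N.
    rewrite -hn -(cardsC I) addnC leq_add2l subset_leq_card //.
    apply/subsetP=> z; rewrite !inE; apply: contraL => zI; rewrite negb_or.
    by rewrite (forall_inP (indI x xI) z zI) (forall_inP (indI y yI) z zI).
  by rewrite -(ler_nat R) natrD; lra.
apply: fractional_factor_criterion => // S T disST lowT.
have [->|[x0 x0T]] := set_0Vmem T; first by rewrite cards0 muln0.
pose d (x : del_vertices I) := #|neighbours x :\: S|.
have degS x : t + a%:R <= #|S|%:R + (d x)%:R + #|I|%:R.
  have : (min_degree G <= #|S| + d x + #|I|)%N.
    apply: leq_trans (min_degree_le (val x)) _; rewrite addnC.
    apply: leq_trans (_ : _ <= #|I| + #|S :|: (neighbours x :\: S)|)%N _.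
      by apply: card_le_del => y; rewrite !inE => xy; case: (y \in S).
    by rewrite leq_add2l leq_card_setU.
  by rewrite -(ler_nat R) !natrD; lra.
have nbrS x y : x != y -> ~~ adj x y ->
    n%:R - t <= #|I|%:R + #|S|%:R + (d x)%:R + (d y)%:R.
  move=> xy nadj; apply: le_trans (hnbr (val x) (val y) _ nadj) _.
    by rewrite (inj_eq val_inj).
  rewrite -!natrD ler_nat -!addnA.
  apply: leq_trans (_ : _ <= #|I| +
     #|S :|: ((neighbours x :\: S) :|: (neighbours y :\: S))|)%N _.
    by apply: card_le_del => z; rewrite !inE => xyz; case: (z \in S).
  rewrite leq_add2l; apply: leq_trans (leq_card_setU _ _) _.
  by rewrite leq_add2l leq_card_setU.
have cardST : (#|I| + (#|S| + #|T|) <= n)%N.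
  have := card_del_le (S :|: T); rewrite hn cardsU.
  by move: disST; rewrite -setI_eq0 => /eqP ->; rewrite cards0 subn0.
have [x1 x1T min1] := arg_minnP d x0T.
(* [T] misses [S], so [T] meets this closed neighbourhood only in [x1] and
   in the [d x1] neighbours of [x1] outside [S]. *)
pose K := x1 |: neighbours x1.
have cardK : (#|T :&: K| <= d x1 + 1)%N.
  rewrite addnC; apply: leq_trans (_ : _ <= #|x1 |: (neighbours x1 :\: S)|)%N _.
    apply/subset_leq_card/subsetP=> x; rewrite !inE => /andP[xT].
    by rewrite (disjointFl disST xT).
  by rewrite cardsU1; case: (_ \notin _); rewrite ?leq_add2r //= add0n leqnSn.
have sumK : (d x1 * #|T :&: K| <= \sum_(x in T :&: K) d x)%N.
  rewrite mulnC -sum_nat_const; apply: leq_sum => x; rewrite inE => /andP[xT _].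
  exact: min1.
have lt1 : (d x1 < a)%N := lowT x1 x1T.
have [T2|[y0 y0T]] := set_0Vmem (T :\: K).
  have TK : T :&: K = T by apply/setIidPl; rewrite -setD_eq0 T2.
  rewrite TK in cardK sumK; apply: leq_trans (leq_add (leqnn _) sumK).
  rewrite -(ler_nat R) natrD !natrM.
  apply: clique_case abR _ _ _ (degS x1) It => //.
  - by rewrite natr1 ler_nat.
  - by rewrite -(natrD R _ 1) ler_nat.
have [x2 x2T min2] := arg_minnP d y0T.
have /setDP[x2inT] : x2 \in T :\: K := x2T.
rewrite !inE negb_or => /andP[x21 nadj].
have sum2 : (d x2 * #|T :\: K| <= \sum_(x in T :\: K) d x)%N.
  by rewrite mulnC -sum_nat_const; apply: leq_sum => x; apply: min2.
rewrite (big_setID K) /= -(cardsID K T).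
apply: leq_trans (leq_add (leqnn _) (leq_add sumK sum2)).
(* Over the integers, [m <= k] is [m < k + 1]: the slack required by the
   arithmetic lemma. *)
rewrite -ltnS -[X in (_ < X)%N]addn1 -(ltr_nat R) !natrD !natrM natrD.
apply: (two_minima_case (i := #|I|%:R) abR tE) => //.
- by rewrite ler_nat min1.
- by rewrite natr1 ler_nat; apply: lowT.
- case: (d x2) => [|k]; [by left | by right; rewrite (ler_nat R 1)].
- by rewrite -(natrD R _ 1) ler_nat.
- by rewrite -!natrD ler_nat cardsID -addnA.
- by apply: nbrS; rewrite 1?eq_sym.
Qed.
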